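(* Let $K\in\mathcal L(\mathcal H)$ and let $\mathcal W=\{(W_i,w_i)\}_{i\in I}$ be an atomic system for $K$ with frame operator $S_{\mathcal W}$. Let $T\in\mathcal L(\mathcal H)$ have closed range, with $T^\dagger T(W_i)\subset W_i$ for all $i\in I$. Then the following are equivalent: (i) $\{(TW_i,w_i)\}_{i\in I}$ is an atomic system for $TK$; (ii) the quotient operator $[(TK)^*/S_{\mathcal W}^{1/2}T^*]$ is bounded; (iii) the quotient operator $[(TK)^*/(TS_{\mathcal W}T^* )^{1/2}]$ is bounded.
   Context: $\mathcal H$ is a separable Hilbert space, $\mathcal L(\mathcal H)$ is the space of bounded linear operators on $\mathcal H$, and $I$ is a countable index set. For a closed subspace $W$, $\pi_W$ denotes the orthogonal projection onto $W$; $R(\cdot)$ and $N(\cdot)$ denote range and kernel. For $T\in\mathcal L(\mathcal H)$ with closed range, the pseudo-inverse $T^\dagger\in\mathcal L(\mathcal H)$ is the unique bounded operator with $N(T^\dagger)=R(T)^\perp$, $R(T^\dagger)=N(T)^\perp$ and $TT^\dagger y=y$ for all $y\in R(T)$. A family $\mathcal W=\{(W_i,w_i)\}_{i\in I}$ of closed subspaces $W_i$ of $\mathcal H$ with weights $w_i>0$ is a Bessel fusion sequence if there is $B<\infty$ with $\sum_{i\in I}w_i^2\|\pi_{W_i}f\|^2\le B\|f\|^2$ for all $f\in\mathcal H$. Its frame operator is the bounded positive operator $S_{\mathcal W}f=\sum_{i\in I}w_i^2\pi_{W_i}(f)$. Put $\big(\sum_{i\in I}\oplus W_i\big)_{\ell^2}=\{\{a_i\}_{i\in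 I}: a_i\in W_i,\ \sum_{i\in I}\|a_i\|^2<\infty\}$ with inner product $\langle\{a_i\},\{c_i\}\rangle=\sum_{i\in I}\langle a_i,c_i\rangle$. $\mathcal W$ is an atomic system for $K\in\mathcal L(\mathcal H)$ if (a) $\mathcal W$ is a Bessel fusion sequence, and (b) there is $C>0$ such that for every $f\in\mathcal H$ there exists $\{a_i\}_{i\in I}\in\big(\sum_{i\in I}\oplus W_i\big)_{\ell^2}$ with $\|\{a_i\}\|\le C\|f\|$ and $Kf=\sum_{i\in I}w_ia_i$. For $U,V\in\mathcal L(\mathcal H)$ with $N(V)\subset N(U)$, the quotient $[U/V]$ is the linear map $R(V)\to R(U)$, $Vf\mapsto Uf$; it is well defined exactly when $N(V)\subset N(U)$, and saying that $[U/V]$ is bounded includes that it is well defined. *)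

(* Defs.v *)
From HB Require Import structures.
From mathcomp Require Import all_boot all_order all_algebra sesquilinear complex.
From mathcomp Require Import finmap.
From mathcomp Require Import boolp classical_sets functions cardinality.
From mathcomp Require Import reals ereal topology normedtype.
From mathcomp Require Import summability esum.

(** Hilbert spaces are built on top of [completeNormedModType], over a scalar
    field that is either [R] or [R[i]] for [R : realType]. *)

Set Implicit Arguments.
Unset Strict Implicit.
Unset Printing Implicit Defensive.

Import Order.TTheory GRing.Theory Num.Theory.
Import numFieldNormedType.Exports.

Local Open Scope classical_set_scope.
Local Open Scope ring_scope.

(** The axioms determine [F] up to isomorphism: if [conjF] fixes every element
    then [ofR] is onto and [F] is [R]; otherwise, for a [z] that is not fixed,
    [y := z - conjF z] satisfies [y ^+ 2 = - `|y| ^+ 2], so [F] is [R[i]]. *)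
HB.mixin Record isRealOrComplex (R : realType) F of Num.NumField F := {
  ofR : {rmorphism R -> F};
  reF : F -> R;
  conjF : involutive_rmorphism F;
  ler_ofR : {mono ofR : x y / x <= y};
  ofR_reF : forall z : F, ofR (reF z) = (z + conjF z) / 2;
  sqr_norm_conjF : forall z : F, `|z| ^+ 2 = z * conjF z
}.

#[short(type="realOrComplexType")]
HB.structure Definition RealOrComplex (R : realType) :=
  {F of isRealOrComplex R F & Num.NumField F}.

Arguments ofR {R s} : rename.
Arguments reF {R s} : rename.
Arguments conjF {R s} : rename.

Section RealScalars.
Variable R : realType.

Let real_le : {mono (idfun : {rmorphism R -> R}) : x y / x <= y}.
Proof. by []. Qed.

Let real_re (z : R) : (idfun : {rmorphism R -> R}) (id z) =
  (z + (idfun : involutive_rmorphism R) z) / 2.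
Proof. by rewrite /= -mulr2n -[z *+ 2]mulr_natr mulfK ?pnatr_eq0. Qed.

Let real_norm (z : R) : `|z| ^+ 2 = z * (idfun : involutive_rmorphism R) z.
Proof. by rewrite /= real_normK ?num_real ?expr2. Qed.

(** Not declared canonical: that would be a non-forgetful inheritance from
    [realType]. *)
Definition real_scalars : realOrComplexType R :=
  HB.pack (Real.sort R) (isRealOrComplex.Build R R real_le real_re real_norm).

End RealScalars.

Section ComplexScalars.
Variable R : realType.
Local Open Scope complex_scope.

HB.instance Definition _ := isInvolutive.Build R[i] (@conjc R) (@conjcK R).

Let complex_le : {mono (real_complex R : {rmorphism R -> R[i]}) : x y / x <= y}.
Proof. by move=> x y; rewrite /= lecR. Qed.

Let complex_re (z : R[i]) :
  (real_complex R : {rmorphism R -> R[i]}) (complex.Re z) =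
  (z + (@conjc R : involutive_rmorphism R[i]) z) / 2.
Proof. exact: ReJ_add. Qed.

Let complex_norm (z : R[i]) :
  `|z| ^+ 2 = z * (@conjc R : involutive_rmorphism R[i]) z.
Proof. by rewrite /= sqr_normc. Qed.

Definition complex_scalars : realOrComplexType R :=
  HB.pack (R[i])
    (isRealOrComplex.Build R R[i] complex_le complex_re complex_norm).

End ComplexScalars.

(** The inner product is linear in its first argument and conjugate-linear in
    the second. *)
HB.mixin Record isHilbert (R : realType) (F : realOrComplexType R) H
    of CompleteNormedModule F H := {
  dot : {dot H for (conjF : F -> F)};
  sqr_norm_dot : forall x : H, `|x| ^+ 2 = dot x x
}.

#[short(type="hilbertType")]
HB.structure Definition Hilbert (R : realType) (F : realOrComplexType R) :=
  {H of isHilbert R F H & CompleteNormedModule F H}.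

Arguments dot {R F s} : rename.

Section Hilbert.
Variables (R : realType) (F : realOrComplexType R) (H : hilbertType F).
Implicit Types (A B U V : H -> H) (W : set H) (x y : H).

Definition separable_space := exists D : set H, countable D /\ dense D.

(** The library norm is [F]-valued; this is its value in [R]. *)
Definition hnorm x : R := reF `|x|.

Definition bounded_operator A :=
  linear A /\ exists M : R, forall x, hnorm (A x) <= M * hnorm x.

Definition kernel A : set H := [set x | A x = 0].

Definition orthogonal_complement (X : set H) : set H :=
  [set y | forall x, X x -> dot x y = 0].

Definition closed_subspace W :=
  [/\ closed W, W 0 & forall (c : F) x y, W x -> W y -> W (c *: x + y)].

(** The operators below are chosen with [xget] among the objects with their
    defining property; each property has exactly one solution under the
    hypotheses given in the comment. *)

(** [W] a closed subspace *)
Definition proj W : H -> H := fun x =>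
  xget 0 [set p | W p /\ orthogonal_complement W (x - p)].

(** [A] a bounded operator *)
Definition adjoint A : H -> H :=
  xget (fun=> 0) [set B | bounded_operator B /\
                          forall x y, dot (A x) y = dot x (B y)].

(** Self-adjointness is not redundant when [F] is [R]. *)
Definition positive_operator A :=
  [/\ bounded_operator A,
      forall x y, dot (A x) y = dot x (A y) &
      forall x, 0 <= dot (A x) x].

(** [A] a positive operator *)
Definition sqrt_operator A : H -> H :=
  xget (fun=> 0) [set B | positive_operator B /\ B \o B = A].

(** [A] a bounded operator with closed range *)
Definition pseudo_inverse A : H -> H :=
  xget (fun=> 0) [set B |
    [/\ bounded_operator B,
        kernel B = orthogonal_complement (range A),
        range B = orthogonal_complement (kernel A) &
        forall y, range A y -> A (B y) = y]].

(** The quotient [[U/V]]; only its values on [range V] matter, and they do not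
    depend on the choice of the preimage when [kernel V `<=` kernel U]. *)
Definition quotient_operator U V : H -> H := fun y =>
  U (xget 0 [set x | V x = y]).

Definition bounded_quotient U V :=
  kernel V `<=` kernel U /\
  exists M : R, forall y, range V y ->
    hnorm (quotient_operator U V y) <= M * hnorm y.

Section Fusion.
Variables (I : countType) (W : I -> set H) (w : I -> R).

Definition bessel_fusion :=
  [/\ forall i, closed_subspace (W i),
      forall i, 0 < w i &
      exists B : R, forall x,
        (\esum_(i in [set: I]) (w i ^+ 2 * hnorm (proj (W i) x) ^+ 2)%:E
           <= (B * hnorm x ^+ 2)%:E)%E].

(** Vector-valued series over [I] are limits of the net of finite partial sums
    ([totally] is the filter of finite subsets of [I] ordered by inclusion). *)
Definition frame_operator : H -> H := fun x =>
  sum (fun i => (ofR (w i ^+ 2) : F) *: proj (W i) x).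

Definition ell2_sum : set (I -> H) :=
  [set a | (forall i, W i (a i)) /\
           (\esum_(i in [set: I]) (hnorm (a i) ^+ 2)%:E < +oo)%E].

Definition ell2_norm (a : I -> H) : R :=
  Num.sqrt (fine (\esum_(i in [set: I]) (hnorm (a i) ^+ 2)%:E)).

Definition atomic_system (K : H -> H) :=
  bessel_fusion /\
  exists C : R, 0 < C /\ forall x, exists a : I -> H,
    [/\ ell2_sum a, ell2_norm a <= C * hnorm x &
        partial_sum (fun i => (ofR (w i) : F) *: a i) @ totally --> K x].

End Fusion.
End Hilbert.

Arguments separable_space {R F} H.

(* Main.v *)
From HB Require Import structures.
Require Import Defs.
From mathcomp Require Import all_boot all_order all_algebra.
From mathcomp Require Import finmap.
From mathcomp Require Import boolp classical_sets functions cardinality fsbigop.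
From mathcomp Require Import reals ereal topology normedtype sequences.
From mathcomp Require Import summability esum.
From mathcomp Require Import lra ring.

(** All three conditions hold as soon as [W] is an atomic system for [K], [T]
    has closed range and [pseudo_inverse T \o T] preserves every [W i]; the
    equivalence follows.  Write [S] for the frame operator of [W] and [P] for
    the pseudo-inverse of [T].

    For the two quotients: if [K x] is the sum of the [w i *: a i], then
    Cauchy-Schwarz in the l2-sum of the [W i] gives
    [`|rdot (K x) y| ^+ 2 <= C ^+ 2 * hnorm x ^+ 2 * rdot (S y) y],
    because [rdot (a i) y = rdot (a i) (proj (W i) y)] and the partial sums of
    [w i ^+ 2 * hnorm (proj (W i) y) ^+ 2] stay below [rdot (S y) y].  With
    [x := adjoint K y] this is the lower frame inequality
    [hnorm (adjoint K y) ^+ 2 <= C ^+ 2 * rdot (S y) y]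
    ([atomic_system_lower_bound]).  It is applied at [adjoint T y]: the left
    member becomes the squared norm of [adjoint (T \o K) y], and
    [rdot (S (adjoint T y)) (adjoint T y)] is the squared norm both of
    [sqrt_operator S (adjoint T y)] and of
    [sqrt_operator (T \o S \o adjoint T) y].

    For the image system: [T (P y) = y] on [range T] and [P \o T] preserves
    [W i], so [T @` W i] is the intersection of [range T] with the preimage of
    [W i] under [P], hence closed.  Each [p] in [T @` W i] is [T (P p)] with
    [P p] in [W i], whence [hnorm (proj (T @` W i) x)] is at most the norm of
    [P] times [hnorm (proj (W i) (adjoint T x))], and the Bessel bound follows.
    The coefficients for [T (K x)] are the images under [T] of those for
    [K x] ([image_atomic_system]).

    The projections, adjoints, square roots and pseudo-inverses are chosen
    objects, so their existence has to be established.  Everything is done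
    with the real inner product [rdot], the real part of [dot].  Projections
    and adjoints come from a variational problem ([variational_solution]),
    square roots of positive operators from an iteration dominated by a scalar
    one ([contraction_iteration]), and the pseudo-inverse from the uniform
    boundedness principle ([weakly_bounded_bounded]), which makes [T] bounded
    below on the orthogonal complement of its kernel
    ([closed_range_bounded_below]). *)

Set Implicit Arguments.
Unset Strict Implicit.
Unset Printing Implicit Defensive.

Import Order.TTheory GRing.Theory Num.Theory.
Import numFieldNormedType.Exports.
Local Open Scope classical_set_scope.
Local Open Scope ring_scope.

#[local] Existing Instance totally_filter.

(** * The scalar field *)

Section Scalars.
Variables (R : realType) (F : realOrComplexType R).
Implicit Types (r s : R) (z : F).

Lemma conjF_ge0 z : 0 <= z -> conjF z = z.
Proof.
move=> z0; have := sqr_norm_conjF z; rewrite ger0_norm// expr2.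
by have [->|nz] := eqVneq z 0; [rewrite rmorph0|move/(mulfI nz)].
Qed.

Lemma ofR_ge0 r : (0 <= (ofR r : F)) = (0 <= r).
Proof. by rewrite -[0 : F](rmorph0 ofR) ler_ofR. Qed.

Lemma ofR_inj : injective (ofR : R -> F).
Proof.
by move=> r s e; apply/eqP; rewrite eq_le -!(ler_ofR (s := F)) e lexx.
Qed.

Lemma conjF_ofR r : conjF (ofR r : F) = ofR r.
Proof.
have [r0|r0] := leP 0 r; first by rewrite conjF_ge0// ofR_ge0.
have : conjF (ofR (- r) : F) = ofR (- r).
  by rewrite conjF_ge0// ofR_ge0 oppr_ge0 ltW.
by rewrite !rmorphN => /oppr_inj.
Qed.

Lemma reF_ofR r : reF (ofR r : F) = r.
Proof.
apply: ofR_inj; rewrite ofR_reF conjF_ofR -mulr2n -[X in X / _]mulr_natr.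
by rewrite mulfK// pnatr_eq0.
Qed.

Lemma ofR_reF_ge0 z : 0 <= z -> ofR (reF z) = z.
Proof.
move=> z0; rewrite ofR_reF conjF_ge0// -mulr2n -[X in X / _]mulr_natr.
by rewrite mulfK// pnatr_eq0.
Qed.

Lemma reF_is_zmod_morphism : zmod_morphism (reF : F -> R).
Proof.
move=> x y; apply: ofR_inj; rewrite rmorphB/= !ofR_reF rmorphB/= -mulrBl.
by congr (_ / _); rewrite opprD addrACA.
Qed.

HB.instance Definition _ :=
  GRing.isZmodMorphism.Build F R (reF : F -> R) reF_is_zmod_morphism.

Lemma reF_ofRM r z : reF (ofR r * z) = r * reF z.
Proof.
apply: ofR_inj; rewrite rmorphM/= !ofR_reF rmorphM/= conjF_ofR.
by rewrite -mulrDr mulrA.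
Qed.

Lemma reF_conjF z : reF (conjF z) = reF z.
Proof. by apply: ofR_inj; rewrite !ofR_reF rmorphK addrC. Qed.

Lemma reF_ge0 z : 0 <= z -> 0 <= reF z.
Proof. by move=> z0; rewrite -ofR_ge0 ofR_reF_ge0. Qed.

Lemma ofR_norm z : ofR (reF `|z|) = `|z|.
Proof. exact: ofR_reF_ge0. Qed.

Lemma norm_ofR r : `|ofR r : F| = ofR `|r|.
Proof.
have [r0|r0] := leP 0 r; first by rewrite !ger0_norm ?ofR_ge0.
by rewrite -normrN -rmorphN -(normrN r) !ger0_norm ?ofR_ge0 ?oppr_ge0 ?ltW.
Qed.

(** A scalar all of whose multiples have zero real part vanishes. *)
Lemma reF_mul_eq0 z : (forall c, reF (c * z) = 0) -> z = 0.
Proof.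
move=> /(_ (conjF z)); rewrite mulrC -sqr_norm_conjF => e.
apply/eqP; rewrite -normr_eq0 -sqrf_eq0 -(ofR_reF_ge0 (exprn_ge0 2 (normr_ge0 z))).
by rewrite e rmorph0.
Qed.

End Scalars.

(** * The real inner product *)

(** A real quadratic polynomial that is nonnegative everywhere has nonpositive
    discriminant; the source of all the Cauchy-Schwarz inequalities below. *)
Lemma discriminant_le (R : realType) (a b c : R) : 0 <= a ->
  (forall t, 0 <= c + 2 * t * b + t ^+ 2 * a) -> b ^+ 2 <= a * c.
Proof.
rewrite le_eqVlt => /predU1P[<-|a0] h.
  have [->|b0] := eqVneq b 0; first by rewrite expr0n mul0r.
  have := h (- (c + 1) / (2 * b)).
  have -> : c + 2 * (- (c + 1) / (2 * b)) * b +
    (- (c + 1) / (2 * b)) ^+ 2 * 0 = -1 by field.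
  by rewrite ler0N1.
have := h (- b / a).
have -> : c + 2 * (- b / a) * b + (- b / a) ^+ 2 * a = c - b ^+ 2 / a.
  by field; rewrite gt_eqF.
by rewrite subr_ge0 ler_pdivrMr// mulrC.
Qed.

Section HilbertSpace.
Variables (R : realType) (F : realOrComplexType R) (H : hilbertType F).
Implicit Types (r s t : R) (c : F) (x y z : H).

(** The real part of the inner product, which makes [H] a real Hilbert space
    with the same norm. *)
Definition rdot x y : R := reF (dot x y).

Lemma norm_hnorm x : `|x| = ofR (hnorm x).
Proof. by rewrite ofR_reF_ge0. Qed.

Lemma hnorm_ge0 x : 0 <= hnorm x.
Proof. exact: reF_ge0. Qed.

Lemma hnorm0 : hnorm (0 : H) = 0.
Proof. by rewrite /hnorm normr0 raddf0. Qed.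

Lemma hnorm_eq0 x : hnorm x = 0 -> x = 0.
Proof. by move=> e; apply/eqP; rewrite -normr_eq0 norm_hnorm e rmorph0. Qed.

Lemma hnormD x y : hnorm (x + y) <= hnorm x + hnorm y.
Proof. by rewrite -(ler_ofR (s := F)) rmorphD/= -!norm_hnorm ler_normD. Qed.

Lemma hnormN x : hnorm (- x) = hnorm x.
Proof. by rewrite /hnorm normrN. Qed.

Lemma hnormB_sym x y : hnorm (x - y) = hnorm (y - x).
Proof. by rewrite -hnormN opprB. Qed.

Lemma hnormB x y : hnorm (x - y) <= hnorm x + hnorm y.
Proof. by rewrite -(hnormN y) hnormD. Qed.

Lemma hnorm_dist x y z : hnorm (x - z) <= hnorm (x - y) + hnorm (y - z).
Proof. by rewrite -[x - z](subrKA y) hnormD. Qed.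

Lemma hnormZ c x : hnorm (c *: x) = reF `|c| * hnorm x.
Proof.
by apply: (@ofR_inj _ F); rewrite rmorphM/= -!norm_hnorm normrZ ofR_norm.
Qed.

Lemma hnormZr r x : hnorm ((ofR r : F) *: x) = `|r| * hnorm x.
Proof. by rewrite hnormZ norm_ofR reF_ofR. Qed.

Lemma dotC x y : dot x y = conjF (dot y x).
Proof. by rewrite hermitian_subproof mul1r. Qed.

Lemma dotDl x y z : dot (x + y) z = dot x z + dot y z.
Proof. exact: linearDl. Qed.

Lemma dotZl c x y : dot (c *: x) y = c * dot x y.
Proof. exact: linearZl_LR. Qed.

Lemma rdotC x y : rdot x y = rdot y x.
Proof. by rewrite /rdot dotC reF_conjF. Qed.

Lemma rdotDl x y z : rdot (x + y) z = rdot x z + rdot y z.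
Proof. by rewrite /rdot dotDl raddfD. Qed.

Lemma rdotZl r x y : rdot ((ofR r : F) *: x) y = r * rdot x y.
Proof. by rewrite /rdot dotZl reF_ofRM. Qed.

Lemma rdotNl x y : rdot (- x) y = - rdot x y.
Proof. by rewrite -[- x]scaleN1r -[-1 : F](rmorphN1 ofR) rdotZl mulN1r. Qed.

Lemma rdotBl x y z : rdot (x - y) z = rdot x z - rdot y z.
Proof. by rewrite rdotDl rdotNl. Qed.

Lemma rdot0l y : rdot 0 y = 0.
Proof. by rewrite -(subrr y) rdotBl subrr. Qed.

Lemma rdotDr x y z : rdot z (x + y) = rdot z x + rdot z y.
Proof. by rewrite !(rdotC z) rdotDl. Qed.

Lemma rdotZr r x y : rdot y ((ofR r : F) *: x) = r * rdot y x.
Proof. by rewrite !(rdotC y) rdotZl. Qed.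

Lemma rdotNr x y : rdot y (- x) = - rdot y x.
Proof. by rewrite !(rdotC y) rdotNl. Qed.

Lemma rdotBr x y z : rdot z (x - y) = rdot z x - rdot z y.
Proof. by rewrite !(rdotC z) rdotBl. Qed.

Lemma rdot0r y : rdot y 0 = 0.
Proof. by rewrite rdotC rdot0l. Qed.

Lemma rdot_sqr x : rdot x x = hnorm x ^+ 2.
Proof.
apply: (@ofR_inj _ F); rewrite rmorphXn/= -norm_hnorm sqr_norm_dot /rdot.
by rewrite ofR_reF_ge0// -sqr_norm_dot exprn_ge0.
Qed.

Lemma sqr_hnormD x y :
  hnorm (x + y) ^+ 2 = hnorm x ^+ 2 + 2 * rdot x y + hnorm y ^+ 2.
Proof.
by rewrite -!rdot_sqr rdotDl !rdotDr (rdotC y x); ring.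
Qed.

Lemma sqr_hnormB x y :
  hnorm (x - y) ^+ 2 = hnorm x ^+ 2 - 2 * rdot x y + hnorm y ^+ 2.
Proof. by rewrite sqr_hnormD rdotNr hnormN mulrN. Qed.

Lemma sqr_rdot_le x y : rdot x y ^+ 2 <= hnorm y ^+ 2 * hnorm x ^+ 2.
Proof.
apply: discriminant_le => [|t]; first exact: sqr_ge0.
have := sqr_ge0 (hnorm (x + (ofR t : F) *: y)).
by rewrite sqr_hnormD rdotZr hnormZr exprMn real_normK ?num_real// mulrA.
Qed.

Lemma norm_rdot_le x y : `|rdot x y| <= hnorm x * hnorm y.
Proof.
rewrite -ler_sqr ?nnegrE ?mulr_ge0 ?hnorm_ge0// real_normK ?num_real// exprMn.
by rewrite mulrC sqr_rdot_le.
Qed.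

Lemma rdot_le x y : rdot x y <= hnorm x * hnorm y.
Proof. exact: le_trans (ler_norm _) (norm_rdot_le _ _). Qed.

(** The inner product is determined by its real part. *)
Lemma rdot_dot x y x' y' :
  (forall c, rdot (c *: x) y = rdot (c *: x') y') -> dot x y = dot x' y'.
Proof.
move=> h; apply/eqP; rewrite -subr_eq0; apply/eqP/reF_mul_eq0 => c.
by rewrite mulrBr raddfB/= -!dotZl -!/(rdot _ _) h subrr.
Qed.

Lemma rdot_inj x y : (forall z, rdot z x = rdot z y) -> x = y.
Proof.
move=> h; apply/eqP; rewrite -subr_eq0; apply/eqP/hnorm_eq0/eqP.
by rewrite -sqrf_eq0 -rdot_sqr rdotBr h subrr.
Qed.

(** * Convergence in the real-valued norm *)

Lemma hcvgP (T : Type) (G : set_system T) (f : T -> H) x : Filter G ->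
  (f @ G --> x) <-> (forall e : R, 0 < e -> \forall t \near G, hnorm (x - f t) < e).
Proof.
move=> FG; split=> [/cvgrPdist_lt h e e0|h].
  have e0' : 0 < (ofR e : F).
    rewrite -[0 : F](rmorph0 ofR) lt_neqAle ler_ofR ltW// andbT.
    by rewrite (inj_eq (@ofR_inj _ _)) lt_eqF.
  have := h _ e0'; apply: filterS => t.
  rewrite norm_hnorm lt_neqAle ler_ofR (inj_eq (@ofR_inj _ _)).
  by rewrite -lt_neqAle.
apply/cvgrPdist_lt => e e0.
have e0' : 0 < reF e.
  rewrite lt_neqAle reF_ge0 ?ltW// andbT.
  by rewrite -(inj_eq (@ofR_inj _ F)) rmorph0 ofR_reF_ge0 ?ltW// lt_eqF.
have := h _ e0'; apply: filterS => t.
rewrite norm_hnorm -[in X in _ -> X](ofR_reF_ge0 (ltW e0)).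
by rewrite [in X in X -> _]lt_neqAle lt_neqAle ler_ofR (inj_eq (@ofR_inj _ _)).
Qed.

Lemma hcauchy (T : Type) (G : set_system T) (f : T -> H) : ProperFilter G ->
  (forall e : R, 0 < e -> exists2 A, G A &
     forall s t : T, A s -> A t -> hnorm (f s - f t) < e) ->
  exists x, f @ G --> x.
Proof.
move=> FG h; apply/cvg_ex; apply/cauchy_cvgP/cauchyP => e e0.
have e0' : 0 < reF e.
  rewrite lt_neqAle reF_ge0 ?ltW// andbT.
  by rewrite -(inj_eq (@ofR_inj _ F)) rmorph0 ofR_reF_ge0 ?ltW// lt_eqF.
have [A GA hA] := h _ e0'; have [s As] := filter_ex GA.
exists (f s); rewrite /nbhs/=; apply: filterS GA => t At.
rewrite -ball_normE/= norm_hnorm -[X in _ < X](ofR_reF_ge0 (ltW e0)).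
by rewrite lt_neqAle ler_ofR (inj_eq (@ofR_inj _ _)) -lt_neqAle hA.
Qed.

End HilbertSpace.

(** * Linear and bounded operators *)

Section LinearMaps.
Variables (R : realType) (F : realOrComplexType R) (H : hilbertType F).
Variables (A : H -> H) (lA : linear A).
Implicit Types (c : F) (x y : H).

Let packed : {linear H -> H} := HB.pack A (GRing.isLinear.Build _ _ _ _ _ lA).

Lemma op0 : A 0 = 0. Proof. exact: (linear0 packed). Qed.

Lemma opB x y : A (x - y) = A x - A y. Proof. exact: (linearB packed). Qed.

Lemma opZ c x : A (c *: x) = c *: A x. Proof. by rewrite -[c *: x]addr0 lA op0 addr0. Qed.

Lemma op_sum (I : Type) (r : seq I) (P : pred I) (f : I -> H) :
  A (\sum_(i <- r | P i) f i) = \sum_(i <- r | P i) A (f i).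
Proof. exact: (linear_sum packed). Qed.

End LinearMaps.

Section Operators.
Variables (R : realType) (F : realOrComplexType R) (H : hilbertType F).
Implicit Types (A B : H -> H) (W : set H) (x y z : H).

Lemma bounded_operatorP A : bounded_operator A ->
  exists2 M : R, 0 < M & forall x, hnorm (A x) <= M * hnorm x.
Proof.
move=> [_ [M hM]]; exists (`|M| + 1) => [|x]; first exact: ltr_wpDl.
apply: le_trans (hM x) _; rewrite ler_wpM2r ?hnorm_ge0//.
by rewrite (le_trans (ler_norm M))// lerDl.
Qed.

Lemma bounded_comp A B :
  bounded_operator A -> bounded_operator B -> bounded_operator (A \o B).
Proof.
move=> bA bB; have [M M0 hM] := bounded_operatorP bA.
have [N N0 hN] := bounded_operatorP bB; split=> [c x y /=|].
  by rewrite bB.1 bA.1.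
exists (M * N) => x /=; apply: le_trans (hM _) _.
by rewrite -mulrA ler_pM2l.
Qed.

Lemma bounded_cvg (T : Type) (G : set_system T) (f : T -> H) A x : Filter G ->
  bounded_operator A -> f @ G --> x -> A \o f @ G --> A x.
Proof.
move=> FG bA /hcvgP h; apply/hcvgP => e e0.
have [M M0 hM] := bounded_operatorP bA.
have := h _ (divr_gt0 e0 M0); apply: filterS => t ht /=.
rewrite -opB; last exact: bA.1.
by apply: le_lt_trans (hM _) _; rewrite mulrC -ltr_pdivlMr.
Qed.

Lemma rdot_cvg (T : Type) (G : set_system T) (f : T -> H) x y : Filter G ->
  f @ G --> x -> rdot (f t) y @[t --> G] --> rdot x y.
Proof.
move=> FG /hcvgP h; apply/cvgrPdist_lt => e e0.
have N0 : 0 < hnorm y + 1 by rewrite ltr_wpDl// hnorm_ge0.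
have := h _ (divr_gt0 e0 N0); apply: filterS => t ht.
rewrite -rdotBl; apply: le_lt_trans (norm_rdot_le _ _) _.
move: ht; rewrite ltr_pdivlMr// => /(le_lt_trans _); apply.
by rewrite ler_wpM2l ?hnorm_ge0// lerDl.
Qed.

(** A sequence that is Cauchy with rate [e] converges, at the same rate. *)
Lemma cauchy_rate (u : nat -> H) (e : nat -> R) :
  e @ \oo --> 0 -> (forall m n, hnorm (u m - u n) <= e m + e n) ->
  exists2 x, u @ \oo --> x & forall n, hnorm (x - u n) <= e n.
Proof.
move=> e_0 h.
have e_small d : 0 < d -> \forall n \near \oo, e n < d.
  by move=> d0; move/cvgrPdist_lt: e_0 => /(_ _ d0); apply: filterS => n;
    rewrite sub0r normrN => /(le_lt_trans (ler_norm _)).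
have [x ux] : exists x, u @ \oo --> x.
  apply: hcauchy => d d0; exists [set n | e n < d / 2].
    by apply: e_small; rewrite divr_gt0.
  by move=> m n /= hm hn; apply: le_lt_trans (h m n) _; lra.
exists x => // n; apply/ler_addgt0Pr => d d0.
move/hcvgP: ux => /(_ _ (divr_gt0 d0 (ltr0Sn _ 1))) ux.
have [m /= [hm hem]] := filter_ex (filterI ux (e_small _ (divr_gt0 d0 (ltr0Sn _ 1)))).
by have := hnorm_dist x (u m) (u n); have := h m n; lra.
Qed.

Lemma closed_subspaceB W x y : closed_subspace W -> W x -> W y -> W (x - y).
Proof.
by move=> [_ _ sW] Wx Wy; rewrite addrC -scaleN1r; apply: sW.
Qed.

Lemma closed_subspaceZ W (c : F) x : closed_subspace W -> W x -> W (c *: x).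
Proof. by move=> [_ W0 sW] Wx; rewrite -[_ *: _]addr0; apply: sW. Qed.

(** Solvability of a coercive symmetric variational problem on a closed
    subspace.  With [A] the identity this is the Riesz representation theorem
    on [W]; with [phi y := rdot (A y) x] it says that [A @` W] contains an
    orthogonal projection of [x]. *)
Lemma variational_solution W A (phi : H -> R) (M c : R) :
  closed_subspace W -> bounded_operator A ->
  (forall x, W x -> hnorm x <= M * hnorm (A x)) ->
  (forall t x y, phi ((ofR t : F) *: x + y) = t * phi x + phi y) ->
  (forall x, W x -> `|phi x| <= c * hnorm (A x)) ->
  exists2 z, W z & forall y, W y -> rdot (A y) (A z) = phi y.
Proof.
move=> sW bA coer lphi bphi; have [clW W0 W_lin] := sW; have lA := bA.1.
pose J v := hnorm (A v) ^+ 2 - 2 * phi v.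
have Jlb v : W v -> - c ^+ 2 <= J v.
  move=> /bphi /(le_trans (ler_norm _)) h.
  by have := sqr_ge0 (hnorm (A v) - c); rewrite /J; nra.
have hinf : has_inf (J @` W).
  by split; [exists (J 0), 0|exists (- c ^+ 2) => _ [v Wv <-]; exact: Jlb].
(* a minimiser of [J] up to [d ^+ 2] solves the Euler equation up to [d],
     because the quadratic [t |-> J (t *: y + v)] stays above [inf J] *)
have approx (d : R) : 0 < d ->
    exists v, W v /\ forall y, W y -> `|rdot (A y) (A v) - phi y| <= d * hnorm (A y).
  move=> d0; have [_ [v Wv <-] Jv] := inf_adherent (exprn_gt0 2 d0) hinf.
  exists v; split=> // y Wy.
  rewrite -ler_sqr ?nnegrE ?mulr_ge0 ?hnorm_ge0 ?(ltW d0)//.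
  rewrite real_normK ?num_real// exprMn mulrC.
  apply: discriminant_le => [|t]; first exact: sqr_ge0.
  have : inf (J @` W) <= J ((ofR t : F) *: y + v).
    by apply: ge_inf; [exact: hinf.2|exists ((ofR t : F) *: y + v) => //; exact: W_lin].
  rewrite {2}/J lphi lA sqr_hnormD hnormZr exprMn real_normK ?num_real// rdotZl.
  by move: Jv; rewrite /J; lra.
pose v n := sval (cid (approx n.+1%:R^-1 (ltac:(by rewrite invr_gt0 ltr0Sn)))).
have vP n : W (v n) /\ forall y, W y ->
    `|rdot (A y) (A (v n)) - phi y| <= n.+1%:R^-1 * hnorm (A y).
  by rewrite /v; case: cid.
have M0 : 0 < `|M| + 1 by exact: ltr_wpDl.
have vcauchy m n : hnorm (v m - v n) <= (`|M| + 1) * (m.+1%:R^-1 + n.+1%:R^-1).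
  have Wd : W (v m - v n) by apply: closed_subspaceB => //; exact: (vP _).1.
  have hm := (vP m).2 _ Wd; have hn := (vP n).2 _ Wd.
  have hd : hnorm (A (v m - v n)) <= m.+1%:R^-1 + n.+1%:R^-1.
    have [e|e0] := eqVneq (hnorm (A (v m - v n))) 0.
      by rewrite e addr_ge0 ?invr_ge0.
    have e1 : 0 < hnorm (A (v m - v n)) by rewrite lt_neqAle eq_sym e0 hnorm_ge0.
    have Ad : A (v m - v n) = A (v m) - A (v n) by exact: opB.
    rewrite -(ler_pM2r e1) -expr2 -rdot_sqr {2}Ad rdotBr mulrDl.
    move: hm hn; rewrite !ler_norml => /andP[_ +] /andP[+ _].
    move: (_ * hnorm _) (_ * hnorm _) => a b. lra.
  apply: le_trans (coer _ Wd) _.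
  rewrite (le_trans (ler_norm _))// normrM (ger0_norm (hnorm_ge0 _)).
  by apply: ler_pM => //; [exact: hnorm_ge0|rewrite lerDl].
have rate0 : (fun n => (`|M| + 1) * n.+1%:R^-1) @ \oo --> (0 : R).
  by rewrite -(mulr0 (`|M| + 1)); apply: cvgZr; exact: cvg_harmonic.
have [|z vz _] := cauchy_rate rate0 (u := v).
  by move=> m n; rewrite -mulrDr.
exists z; first by apply: (closed_cvg _ clW _ _ vz); near=> n; exact: (vP n).1.
move=> y Wy; apply/eqP; rewrite -subr_eq0 -normr_le0.
have cv : `|rdot (A (v n)) (A y) - phi y| @[n --> \oo] -->
          `|rdot (A z) (A y) - phi y|.
  apply: cvg_norm; apply: cvgB; last exact: cvg_cst.
  by apply: rdot_cvg; exact: bounded_cvg vz.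
have cv0 : harmonic n * hnorm (A y) @[n --> \oo] --> (0 : R).
  by rewrite -(mul0r (hnorm (A y))); apply: cvgMl; exact: cvg_harmonic.
rewrite rdotC; apply: ler_cvg_to cv cv0 _; near=> n.
by rewrite rdotC; exact: (vP n).2.
Unshelve. all: by end_near. Qed.

End Operators.

(** * Orthogonal projections and adjoints *)

Section ProjectionAdjoint.
Variables (R : realType) (F : realOrComplexType R) (H : hilbertType F).
Implicit Types (A B : H -> H) (W : set H) (x y z : H).

Lemma id_bounded : bounded_operator (@idfun H).
Proof. by split=> //; exists 1 => x; rewrite mul1r. Qed.

(** On an [F]-linear subspace, orthogonality for [rdot] and for [dot] agree. *)
Lemma orthogonal_complementP W y : closed_subspace W ->
  (forall x, W x -> rdot x y = 0) -> orthogonal_complement W y.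
Proof.
move=> sW h x Wx; rewrite -[RHS](_ : dot (0 : H) y = 0); last first.
  by rewrite /dot linear0l.
apply: rdot_dot => c; rewrite scaler0 rdot0l h//.
exact: closed_subspaceZ.
Qed.

Lemma projP W x : closed_subspace W ->
  W (proj W x) /\ orthogonal_complement W (x - proj W x).
Proof.
move=> sW; rewrite /proj.
apply: (@xgetPex _ _ (fun p => W p /\ orthogonal_complement W (x - p))).
have [|||z Wz hz] :=
  @variational_solution _ _ _ W idfun (fun y => rdot y x) 1 (hnorm x) sW id_bounded.
- by move=> y _; rewrite mul1r.
- by move=> t y y'; rewrite rdotDl rdotZl.
- by move=> y _; rewrite mulrC; exact: norm_rdot_le.
exists z; split=> //; apply: orthogonal_complementP => // y Wy.
by rewrite rdotBr -(hz y Wy) subrr.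
Qed.

Section Projection.
Variables (W : set H) (sW : closed_subspace W).

Lemma proj_in x : W (proj W x).
Proof. exact: (projP x sW).1. Qed.

Lemma rdot_proj x y : W x -> rdot x (proj W y) = rdot x y.
Proof.
move=> Wx; have := (projP y sW).2 x Wx => h.
by apply/esym/eqP; rewrite -subr_eq0 -rdotBr /rdot h raddf0.
Qed.

Lemma proj_eq x p : W p -> (forall y, W y -> rdot y p = rdot y x) -> proj W x = p.
Proof.
move=> Wp h; apply/eqP; rewrite -subr_eq0; apply/eqP/hnorm_eq0/eqP.
have Wd : W (proj W x - p) by apply: closed_subspaceB => //; exact: proj_in.
by rewrite -sqrf_eq0 -rdot_sqr rdotBr rdot_proj// h// subrr.
Qed.

Lemma proj_id x : W x -> proj W x = x.
Proof. by move=> Wx; exact: proj_eq. Qed.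

Lemma rdot_projC x y : rdot (proj W x) y = rdot x (proj W y).
Proof.
rewrite -(rdot_proj y (proj_in x)) rdotC (rdot_proj x (proj_in y)).
exact: rdotC.
Qed.

Lemma sqr_hnorm_proj x : hnorm (proj W x) ^+ 2 = rdot x (proj W x).
Proof. by rewrite -rdot_sqr rdot_proj; [exact: rdotC|exact: proj_in]. Qed.

Lemma hnorm_proj_le x : hnorm (proj W x) <= hnorm x.
Proof.
have [->|n0] := eqVneq (hnorm (proj W x)) 0; first exact: hnorm_ge0.
have n1 : 0 < hnorm (proj W x) by rewrite lt_neqAle eq_sym n0 hnorm_ge0.
by rewrite -(ler_pM2r n1) -expr2 sqr_hnorm_proj rdot_le.
Qed.

Lemma proj_linear : linear (proj W).
Proof.
move=> c x y; apply: proj_eq.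
  by case: sW => _ _; apply; exact: proj_in.
move=> z Wz; rewrite !rdotDr rdot_proj//; congr (_ + _).
rewrite !(rdotC z) /rdot !dotZl; congr (reF (c * _)).
rewrite dotC [RHS]dotC; congr (conjF _).
apply: rdot_dot => d; apply: rdot_proj; exact: closed_subspaceZ.
Qed.

End Projection.

Lemma adjointP A : bounded_operator A ->
  bounded_operator (adjoint A) /\ forall x y, dot (A x) y = dot x (adjoint A y).
Proof.
move=> bA; rewrite /adjoint.
apply: (@xgetPex _ _
  (fun B => bounded_operator B /\ forall x y, dot (A x) y = dot x (B y))).
have [M M0 hM] := bounded_operatorP bA; have lA := bA.1.
have sT : closed_subspace [set: H] by split=> //; exact: closedT.
have ex y : exists z, forall x, rdot x z = rdot (A x) y.
  have [|||z _ hz] := @variational_solution _ _ _ setT idfun (fun x => rdot (A x) y)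
    1 (M * hnorm y) sT id_bounded.
  - by move=> x _; rewrite mul1r.
  - by move=> t x x'; rewrite lA rdotDl rdotZl.
  - move=> x _; apply: le_trans (norm_rdot_le _ _) _.
    by rewrite mulrAC ler_wpM2r ?hnorm_ge0.
  by exists z => x; rewrite hz.
pose B y := sval (cid (ex y)).
have rB x y : rdot x (B y) = rdot (A x) y by rewrite /B; case: cid.
have dB x y : dot (A x) y = dot x (B y).
  by apply: rdot_dot => c; rewrite rB opZ.
exists B; split=> //; split.
  move=> c y y'; apply: rdot_inj => x; rewrite rB !rdotDr rB; congr (_ + _).
  rewrite !(rdotC _ (c *: _)) /rdot !dotZl; congr (reF (c * _)).
  by rewrite dotC dB -dotC.
exists M => y; have [->|n0] := eqVneq (hnorm (B y)) 0.
  by rewrite mulr_ge0 ?hnorm_ge0// ltW.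
have n1 : 0 < hnorm (B y) by rewrite lt_neqAle eq_sym n0 hnorm_ge0.
rewrite -(ler_pM2r n1) -expr2 -rdot_sqr rB; apply: le_trans (rdot_le _ _) _.
by rewrite mulrAC ler_wpM2r ?hnorm_ge0.
Qed.

Lemma adjoint_bounded A : bounded_operator A -> bounded_operator (adjoint A).
Proof. by move=> /adjointP[]. Qed.

Lemma rdot_adjoint A x y : bounded_operator A ->
  rdot (A x) y = rdot x (adjoint A y).
Proof. by move=> /adjointP[_ h]; rewrite /rdot h. Qed.

Lemma adjoint_comp A B : bounded_operator A -> bounded_operator B ->
  adjoint (A \o B) = adjoint B \o adjoint A.
Proof.
move=> bA bB; apply/funext => y; apply: rdot_inj => z /=.
by rewrite -!rdot_adjoint//; exact: bounded_comp.
Qed.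

End ProjectionAdjoint.

(** * The uniform boundedness principle *)

Section UniformBoundedness.
Variables (R : realType) (F : realOrComplexType R) (H : hilbertType F).
Implicit Types (x y z : H).

(** Increments dominated by those of a scalar sequence decreasing to [0]. *)
Lemma cauchy_telescope (u : nat -> H) (e : nat -> R) :
  e @ \oo --> 0 -> (forall n, 0 <= e n) ->
  (forall n, hnorm (u n.+1 - u n) <= e n - e n.+1) ->
  exists2 x, u @ \oo --> x & forall n, hnorm (x - u n) <= e n.
Proof.
move=> e_0 e_ge0 h.
have tel n k : hnorm (u (n + k)%N - u n) <= e n - e (n + k)%N.
  elim: k => [|k IH]; first by rewrite addn0 !subrr hnorm0.
  have := hnorm_dist (u (n + k.+1)%N) (u (n + k)%N) (u n).
  by have := h (n + k)%N; rewrite -addnS; lra.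
apply: cauchy_rate e_0 _ => m n; wlog nm : m n / (n <= m)%N.
  move=> W; have [|/ltnW mn] := leqP n m; first exact: W.
  by rewrite hnormB_sym [e m + e n]addrC; exact: W.
by rewrite -(subnKC nm); have := tel n (m - n)%N; have := e_ge0 (n + (m - n))%N; lra.
Qed.

(** The uniform boundedness principle for the functionals [rdot^~ y], [y] in
    [Y], by a gliding hump: if [Y] is unbounded, one builds a convergent series
    whose sum has unbounded inner products with a sequence of [Y]. *)
Lemma weakly_bounded_bounded (Y : set H) :
  (forall z, exists M, forall y, Y y -> `|rdot z y| <= M) ->
  exists M, forall y, Y y -> hnorm y <= M.
Proof.
move=> wb; apply: contrapT => ub.
have big n : exists y, Y y /\ n%:R * 3 ^+ n < hnorm y.
  apply: contrapT => h; apply: ub; exists (n%:R * 3 ^+ n) => y Yy.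
  by rewrite leNgt; apply/negP => ny; apply: h; exists y.
pose y n := sval (cid (big n)).
have yP n : Y (y n) /\ n%:R * 3 ^+ n < hnorm (y n) by rewrite /y; case: cid.
have y_gt0 n : 0 < hnorm (y n).
  by apply: le_lt_trans (yP n).2; rewrite mulr_ge0// exprn_ge0.
(* each step of length 3^-n goes in the direction of [y n], with the sign
   that does not decrease the inner product with [y n] in absolute value *)
pose sg (t : R) : R := if 0 <= t then 1 else -1.
pose step n v : H := (ofR (sg (rdot v (y n)) * 3^-1 ^+ n / hnorm (y n)) : F) *: y n.
pose z := fix z n := if n is n'.+1 then z n' + step n' (z n') else 0.
have p3 n : (0 : R) < 3^-1 ^+ n by rewrite exprn_gt0// invr_gt0.
have sgE t : sg t * t = `|t|.
  by rewrite /sg; case: leP => t0; [rewrite mul1r ger0_norm|rewrite mulN1r ltr0_norm].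
have nsg t : `|sg t| = 1 by rewrite /sg; case: ifP; rewrite ?normrN normr1.
have nstep n v : hnorm (step n v) = 3^-1 ^+ n.
  rewrite /step hnormZr !normrM nsg mul1r normfV (gtr0_norm (p3 n)).
  by rewrite (gtr0_norm (y_gt0 n)) divfK// gt_eqF.
have [|n|n|x zx xz] := @cauchy_telescope z (fun n => 3 / 2 * 3^-1 ^+ n).
- rewrite -[X in _ --> X](mulr0 (3 / 2)); apply: cvgZr; apply: cvg_expr.
  by rewrite ger0_norm ?invr_ge0// invf_lt1 ?ltr1n.
- by rewrite mulr_ge0 ?ltW ?divr_gt0.
- rewrite addrC addKr nstep exprSr; lra.
have [M hM] := wb x.
(* the steps after the n-th one move [x] by at most half of [3^-n], so the
   inner product of [x] with [y n] exceeds [n / 2] *)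
have [n hn] : exists n : nat, 2 * M < n%:R.
  exists (Num.bound `|2 * M|).
  exact: le_lt_trans (ler_norm _) (archi_boundP (normr_ge0 _)).
have := hM _ (yP n).1.
have zn : 3^-1 ^+ n * hnorm (y n) <= `|rdot (z n.+1) (y n)|.
  rewrite /= /step rdotDl rdotZl rdot_sqr; set t := rdot (z n) (y n).
  have -> : sg t * 3^-1 ^+ n / hnorm (y n) * hnorm (y n) ^+ 2 =
      sg t * (3^-1 ^+ n * hnorm (y n)).
    by rewrite expr2 mulrA divfK ?mulrA// gt_eqF.
  have q0 : 0 <= 3^-1 ^+ n * hnorm (y n) by rewrite mulr_ge0 ?hnorm_ge0// ltW.
  rewrite -[leRHS]mul1r -(nsg t) -normrM mulrDr sgE mulrA -expr2.
  rewrite -real_normK ?num_real// nsg expr1n mul1r.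
  by rewrite ger0_norm ?addr_ge0// lerDr.
have dx : `|rdot (z n.+1 - x) (y n)| <= 3^-1 ^+ n / 2 * hnorm (y n).
  apply: le_trans (norm_rdot_le _ _) _; rewrite ler_wpM2r ?hnorm_ge0//.
  by rewrite hnormB_sym; apply: le_trans (xz n.+1) _; rewrite exprSr; lra.
have ny : n%:R <= 3^-1 ^+ n * hnorm (y n).
  rewrite exprVn mulrC ler_pdivlMr ?exprn_gt0//; exact: ltW (yP n).2.
have := ler_normD (rdot (z n.+1 - x) (y n)) (rdot x (y n)).
by rewrite -rdotDl subrK; lra.
Qed.

End UniformBoundedness.

(** * Pseudo-inverses of operators with closed range *)

Section PseudoInverse.
Variables (R : realType) (F : realOrComplexType R) (H : hilbertType F).
Variable T : H -> H.
Hypothesis bT : bounded_operator T.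
Implicit Types (x y z : H).

Lemma kernel_closed_subspace : closed_subspace (kernel T).
Proof.
split.
- move=> x clx; apply: hnorm_eq0; apply/eqP; rewrite eq_le hnorm_ge0 andbT.
  have [M M0 hM] := bounded_operatorP bT.
  apply/ler_addgt0Pl => e e0; rewrite addr0.
  have : nbhs x [set y | hnorm (x - y) < e / M].
    by move/hcvgP: (@cvg_id _ (nbhs x)); apply; rewrite divr_gt0.
  move=> /clx[y [/= Ty xy]]; rewrite -[T x]subr0 -Ty -(opB bT.1).
  by apply: le_trans (hM _) _; rewrite mulrC -ler_pdivlMr// ltW.
- exact: op0 bT.1.
- by move=> c x y Tx Ty; rewrite /kernel/= bT.1 Tx Ty scaler0 addr0.
Qed.

Hypothesis clT : closed (range T).

Lemma range_closed_subspace : closed_subspace (range T).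
Proof.
split=> //; first by exists 0 => //; exact: op0 bT.1.
by move=> c _ _ [x _ <-] [y _ <-]; exists (c *: x + y) => //; rewrite bT.1.
Qed.

Let bT' : bounded_operator (adjoint T) := adjoint_bounded bT.

(** The vectors [y] of [range T] with [hnorm (adjoint T y) <= 1] are weakly
    bounded: [rdot y z] only depends on the projection [T x] of [z] on
    [range T], and [rdot y (T x) = rdot (adjoint T y) x]. *)
Lemma adjoint_bounded_below :
  exists M, forall y, range T y -> hnorm y <= M * hnorm (adjoint T y).
Proof.
have sR := range_closed_subspace.
have [z|M hM] := @weakly_bounded_bounded _ _ H
    [set y | range T y /\ hnorm (adjoint T y) <= 1].
  have [x _ Tx] := proj_in sR z.
  exists (hnorm x) => y [Ry hy].
  rewrite rdotC -(rdot_proj sR)// -Tx rdotC rdot_adjoint//.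
  by apply: le_trans (norm_rdot_le _ _) _; rewrite ler_piMr ?hnorm_ge0.
exists M => y Ry; have [e|n0] := eqVneq (hnorm (adjoint T y)) 0.
  have [x _ Tx] := Ry; have : hnorm y ^+ 2 = 0.
    by rewrite -rdot_sqr -{1}Tx rdot_adjoint// (hnorm_eq0 e) rdot0r.
  by move=> /eqP; rewrite sqrf_eq0 e mulr0 => /eqP ->.
have n1 : 0 < hnorm (adjoint T y) by rewrite lt_neqAle eq_sym n0 hnorm_ge0.
have n2 : 0 <= (hnorm (adjoint T y))^-1 by rewrite invr_ge0 ltW.
have := hM ((ofR (hnorm (adjoint T y))^-1 : F) *: y); rewrite hnormZr ger0_norm//.
rewrite mulrC ler_pdivrMr//; apply; split; first exact: closed_subspaceZ.
by rewrite opZ ?hnormZr ?ger0_norm ?mulVf//; exact: bT'.1.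
Qed.

(** The bounded inverse theorem for [T] restricted to the orthogonal
    complement of its kernel, which is the range of the adjoint. *)
Lemma closed_range_bounded_below : exists M, forall x,
  orthogonal_complement (kernel T) x -> hnorm x <= M * hnorm (T x).
Proof.
have [M hM] := adjoint_bounded_below; exists M => x Nx.
have sR := range_closed_subspace; have lT := bT.1.
(* [adjoint T z] is the projection of [x] on the range of the adjoint *)
have [|y _|z Rz hz] := variational_solution (c := hnorm x)
  (phi := fun y => rdot (adjoint T y) x) sR bT' hM.
- by move=> t y y'; rewrite bT'.1 rdotDl rdotZl.
- by rewrite mulrC; exact: norm_rdot_le.
have Tz : T (x - adjoint T z) = 0.
  apply: rdot_inj => y; rewrite rdot0r.
  set u := T _.
  have Ru : range T u by exists (x - adjoint T z).
  have : rdot u u = 0.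
    by rewrite {2}/u rdotC rdot_adjoint// rdotC rdotBr hz// subrr.
  rewrite rdot_sqr => /eqP; rewrite sqrf_eq0 => /eqP/hnorm_eq0 ->.
  exact: rdot0r.
have xz : x = adjoint T z.
  apply/eqP; rewrite -subr_eq0; apply/eqP/hnorm_eq0/eqP.
  rewrite -sqrf_eq0 -rdot_sqr rdotBr {1}/rdot (Nx _ Tz) raddf0.
  by rewrite -rdot_adjoint// Tz rdot0l subrr.
have [->|n0] := eqVneq x 0.
  by rewrite (op0 lT) !hnorm0 mulr0.
have n1 : 0 < hnorm x.
  rewrite lt_neqAle hnorm_ge0 andbT eq_sym; apply: contra n0.
  by move=> /eqP/hnorm_eq0 ->.
rewrite -(ler_pM2r n1) -expr2 -rdot_sqr {2}xz -rdot_adjoint//.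
apply: le_trans (rdot_le _ _) _.
by rewrite mulrC mulrAC ler_wpM2r ?hnorm_ge0// xz hM.
Qed.

Lemma pseudo_inverseP :
  [/\ bounded_operator (pseudo_inverse T),
      kernel (pseudo_inverse T) = orthogonal_complement (range T),
      range (pseudo_inverse T) = orthogonal_complement (kernel T) &
      forall y, range T y -> T (pseudo_inverse T y) = y].
Proof.
rewrite /pseudo_inverse; apply: (@xgetPex _ _ (fun B => [/\ bounded_operator B,
  kernel B = orthogonal_complement (range T),
  range B = orthogonal_complement (kernel T) &
  forall y, range T y -> T (B y) = y])).
have sR := range_closed_subspace; have sN := kernel_closed_subspace.
have lT := bT.1.
have ex z : exists x, orthogonal_complement (kernel T) x /\ T x = proj (range T) z.
  have [x _ Tx] := proj_in sR z; exists (x - proj (kernel T) x); split.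
    exact: (projP x sN).2.
  by rewrite opB// (_ : T (proj _ _) = 0) ?subr0//; exact: (proj_in sN).
pose B z := sval (cid (ex z)).
have BP z : orthogonal_complement (kernel T) (B z) /\ T (B z) = proj (range T) z.
  by rewrite /B; case: cid.
have inj x y : orthogonal_complement (kernel T) x ->
    orthogonal_complement (kernel T) y -> T x = T y -> x = y.
  move=> Nx Ny e; have k : kernel T (x - y) by rewrite /kernel/= opB// e subrr.
  apply/eqP; rewrite -subr_eq0; apply/eqP/hnorm_eq0/eqP.
  by rewrite -sqrf_eq0 -rdot_sqr rdotBr /rdot Nx// Ny// subrr.
have [M hM] := closed_range_bounded_below.
have lB : linear B.
  move=> c x y; apply: inj; first exact: (BP _).1.
    move=> u ku; rewrite dotC linearDl linearZl_LR/= -!/(dot _ _).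
    by rewrite (dotC _ u) (dotC _ u) !(BP _).1// rmorph0 mulr0 addr0 rmorph0.
  by rewrite lT !(BP _).2 proj_linear.
exists B; split.
- split=> //; exists `|M| => z; apply: le_trans (hM _ (BP z).1) _.
  rewrite (BP z).2; apply: le_trans (ler_wpM2r (hnorm_ge0 _) (ler_norm M)) _.
  by rewrite ler_wpM2l// hnorm_proj_le.
- apply/seteqP; split=> z.
    move=> Bz y Ry; have := (projP z sR).2 y Ry.
    by rewrite -(BP z).2 Bz (op0 lT) subr0.
  move=> Nz; apply: inj; first exact: (BP _).1.
    by move=> u _; rewrite /dot linear0r.
  rewrite (BP z).2 op0//; apply: proj_eq => //; first by case: sR.
  by move=> y Ry; rewrite rdot0r /rdot Nz// raddf0.
- apply/seteqP; split=> [_ [z _ <-]|x Nx]; first exact: (BP z).1.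
  exists (T x) => //; apply: inj => //; first exact: (BP _).1.
  by rewrite (BP _).2 proj_id//; exists x.
- by move=> y Ry; rewrite (BP y).2 proj_id.
Qed.

End PseudoInverse.

(** * Square roots of positive operators *)

Section PositiveSquareRoot.
Variables (R : realType) (F : realOrComplexType R) (H : hilbertType F).
Implicit Types (A B : H -> H) (x y z : H).

Lemma scaler_linear (a : F) : linear (fun x : H => a *: x).
Proof. by move=> c x y; rewrite scalerDr !scalerA mulrC. Qed.

(** Symmetry and positivity may be checked on real parts. *)
Lemma positive_operatorI A : bounded_operator A ->
  (forall x y, rdot (A x) y = rdot x (A y)) -> (forall x, 0 <= rdot (A x) x) ->
  positive_operator A.
Proof.
move=> bA symA posA.
have dsym x y : dot (A x) y = dot x (A y).
  by apply: rdot_dot => c; rewrite -(opZ bA.1) symA.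
split=> // x; have -> : dot (A x) x = ofR (rdot (A x) x); last by rewrite ofR_ge0.
rewrite ofR_reF -dotC -dsym -mulr2n -[X in X / _]mulr_natr.
by rewrite mulfK// pnatr_eq0.
Qed.

Lemma rdot_positiveC A x y : positive_operator A -> rdot (A x) y = rdot x (A y).
Proof. by move=> [_ h _]; rewrite /rdot h. Qed.

Lemma rdot_positive_ge0 A x : positive_operator A -> 0 <= rdot (A x) x.
Proof. by move=> [_ _ h]; exact: reF_ge0. Qed.

Lemma linear_limit (T : Type) (G : set_system T) (f : T -> H -> H) A :
  ProperFilter G -> (forall t, linear (f t)) ->
  (forall x, f t x @[t --> G] --> A x) -> linear A.
Proof.
move=> FG lf fA c x y; apply/esym.
have : f t (c *: x + y) @[t --> G] --> c *: A x + A y.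
  rewrite (_ : (fun t => _) = (fun t => c *: f t x + f t y)).
    by apply: cvgD => //; exact: cvgZr.
  by apply/funext => t; rewrite lf.
by move=> h; exact: (cvg_unique (@norm_hausdorff _ H) h (fA _)).
Qed.

Lemma symmetric_limit (T : Type) (G : set_system T) (f : T -> H -> H) A :
  ProperFilter G -> (forall t x y, rdot (f t x) y = rdot x (f t y)) ->
  (forall x, f t x @[t --> G] --> A x) ->
  forall x y, rdot (A x) y = rdot x (A y).
Proof.
move=> FG sf fA x y; rewrite [RHS]rdotC.
have c1 : rdot (f t x) y @[t --> G] --> rdot (A x) y by exact: rdot_cvg.
have c2 : rdot (f t x) y @[t --> G] --> rdot (A y) x.
  rewrite (_ : (fun t => _) = (fun t => rdot (f t y) x)); first exact: rdot_cvg.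
  by apply/funext => t; rewrite sf rdotC.
exact: (cvg_unique (@Rhausdorff R) c1 c2).
Qed.

Lemma hnorm_limit_le (T : Type) (G : set_system T) (f : T -> H) x (c : R) :
  ProperFilter G -> (forall t, hnorm (f t) <= c) -> f @ G --> x -> hnorm x <= c.
Proof.
move=> FG fc /hcvgP h; apply/ler_addgt0Pr => e e0.
have [t ht] := filter_ex (h _ e0).
by have := hnormD (x - f t) (f t); rewrite subrK; have := fc t; lra.
Qed.

(** For a symmetric contraction [C] there is a symmetric contraction [X] with
    [2 X = C + X ^ 2], so that [1 - X] is a square root of [1 - C].  It is the
    limit of the iteration [X_(n+1) = (C + X_n ^ 2) / 2] from [X_0 = 0]; the
    increments of [X_n] are bounded in norm by those of the scalar sequence [q]
    given by the same recursion with [1] for [C]. *)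
Lemma contraction_iteration C : linear C ->
  (forall x y, rdot (C x) y = rdot x (C y)) ->
  (forall x, hnorm (C x) <= hnorm x) ->
  exists X : H -> H, [/\ linear X, forall x y, rdot (X x) y = rdot x (X y),
    forall x, hnorm (X x) <= hnorm x &
    forall x, (ofR 2 : F) *: X x = C x + X (X x)].
Proof.
move=> lC sC nC.
pose X := fix X n x : H := if n is n'.+1 then
  (ofR 2^-1 : F) *: (C x + X n' (X n' x)) else 0.
pose q := fix q n : R := if n is n'.+1 then 2^-1 * (1 + q n' ^+ 2) else 0.
have q01 n : 0 <= q n <= 1 by elim: n => [|n IH] /=; [rewrite lexx ler01|nra].
have q0 n : 0 <= q n by case/andP: (q01 n).
have q1 n : q n <= 1 by case/andP: (q01 n).
have qS n : q n <= q n.+1 by have := sqr_ge0 (1 - q n); rewrite /=; nra.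
have half : `|2^-1 : R| = 2^-1 by rewrite ger0_norm// invr_ge0.
have lX n : linear (X n).
  elim: n => [|n IH] c x y /=; first by rewrite scaler0 addr0.
  by rewrite lC !IH addrACA -scalerDr scaler_linear.
have sX n x y : rdot (X n x) y = rdot x (X n y).
  elim: n x y => [|n IH] x y /=; first by rewrite rdot0l rdot0r.
  by rewrite rdotZl rdotZr rdotDl rdotDr sC !IH.
have nX n x : hnorm (X n x) <= q n * hnorm x.
  elim: n x => [|n IH] x /=; first by rewrite hnorm0 mul0r.
  rewrite hnormZr half -mulrA ler_pM2l ?invr_gt0// mulrDl mul1r.
  apply: le_trans (hnormD _ _) _; apply: lerD => //.
  by apply: le_trans (IH _) _; rewrite expr2 -mulrA ler_wpM2l.
have dX n x : hnorm (X n.+1 x - X n x) <= (q n.+1 - q n) * hnorm x.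
  elim: n x => [|n IH] x.
    rewrite /= !subr0 addr0 expr0n addr0 mulr1 hnormZr half.
    by rewrite ler_pM2l ?invr_gt0.
  have -> : X n.+2 x - X n.+1 x = (ofR 2^-1 : F) *:
     (X n.+1 (X n.+1 x - X n x) + (X n.+1 (X n x) - X n (X n x))).
    rewrite (opB (lX n.+1)) subrKA /= -scalerBr; congr (_ *: _).
    by rewrite opprD addrACA subrr add0r.
  have -> : q n.+2 - q n.+1 = 2^-1 * ((q n.+1 + q n) * (q n.+1 - q n)).
    by rewrite /=; ring.
  rewrite hnormZr half -mulrA ler_pM2l ?invr_gt0//.
  apply: le_trans (hnormD _ _) _; rewrite -mulrA mulrDl; apply: lerD.
    by apply: le_trans (nX _ _) _; rewrite ler_wpM2l.
  apply: le_trans (IH _) _; rewrite mulrCA ler_wpM2l ?subr_ge0//.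
have [Q qQ Q_ge] : exists2 Q, q @ \oo --> Q & forall n, q n <= Q.
  exists (sup (range q)).
    apply: nondecreasing_cvgn; first by apply/nondecreasing_seqP.
    by exists 1 => _ [n _ <-].
  move=> n; apply: ub_le_sup; last by exists n.
  by exists 1 => _ [k _ <-].
have rate0 x : (fun n => (Q - q n) * hnorm x) @ \oo --> 0.
  rewrite -[X in _ --> X](mul0r (hnorm x)) -(subrr Q); apply: cvgMl.
  by apply: cvgB => //; exact: cvg_cst.
have limX x : exists l, X n x @[n --> \oo] --> l /\
    forall n, hnorm (l - X n x) <= (Q - q n) * hnorm x.
  have [||l Xl ratel] := @cauchy_telescope _ _ H (X^~ x) _ (rate0 x).
  - by move=> n; rewrite mulr_ge0 ?hnorm_ge0// subr_ge0.
  - by move=> n; apply: le_trans (dX _ _) _; rewrite -mulrBl ler_wpM2r ?hnorm_ge0//; lra.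
  by exists l.
pose L x := sval (cid (limX x)).
have LP x : X n x @[n --> \oo] --> L x /\
    forall n, hnorm (L x - X n x) <= (Q - q n) * hnorm x.
  by rewrite /L; case: cid.
have lL : linear L by apply: (@linear_limit nat \oo X L _ lX) => x; exact: (LP x).1.
exists L; split=> //.
- by apply: (@symmetric_limit nat \oo X L _ sX) => x; exact: (LP x).1.
- move=> x; apply: (hnorm_limit_le _ _ (LP x).1) => n.
  by apply: le_trans (nX _ _) _; rewrite ler_piMl ?hnorm_ge0.
move=> x.
have XX : X n (X n x) @[n --> \oo] --> L (L x).
  apply/hcvgP => e e0.
  have : (Q - q n) * hnorm (L x) + (Q - q n) * hnorm x @[n --> \oo] --> (0 : R).
    by rewrite -[X in _ --> X](addr0 0); apply: cvgD; exact: rate0.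
  move=> /cvgrPdist_lt h; have := h _ e0; apply: filterS => n.
  rewrite sub0r normrN; apply: le_lt_trans.
  apply: le_trans (hnorm_dist _ (X n (L x)) _) _; apply: le_trans (ler_norm _).
  apply: lerD; first exact: (LP (L x)).2.
  rewrite -(opB (lX n)); apply: le_trans (nX _ _) _.
  apply: le_trans (_ : hnorm (L x - X n x) <= _); last exact: (LP x).2.
  by rewrite ler_piMl ?hnorm_ge0.
have h1 : X n.+1 x @[n --> \oo] --> (ofR 2^-1 : F) *: (C x + L (L x)).
  by apply: cvgZr; apply: cvgD => //; exact: cvg_cst.
have h2 : X n.+1 x @[n --> \oo] --> L x by rewrite (cvg_shiftS (X^~ x)); exact: (LP x).1.
rewrite -[in LHS](cvg_unique (@norm_hausdorff _ H) h1 h2) scalerA -rmorphM/=.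
by rewrite divff ?pnatr_eq0 ?rmorph1 ?scale1r.
Qed.

Lemma positive_sqrt_exists A : positive_operator A ->
  exists B, positive_operator B /\ B \o B = A.
Proof.
move=> pA; have [bA _ _] := pA; have lA := bA.1.
have [M M0 hM] := bounded_operatorP bA.
(* [C = 1 - A / M] is a contraction: [hnorm (C x) ^+ 2] is at most
   [hnorm x ^+ 2 - rdot (A x) x / M] by [AM] below *)
pose C x := x - (ofR M^-1 : F) *: A x.
have lC : linear C.
  move=> c x y; rewrite /C lA scaler_linear opprD addrACA.
  by rewrite -scalerBr.
have sC x y : rdot (C x) y = rdot x (C y).
  by rewrite /C rdotBl rdotBr rdotZl rdotZr rdot_positiveC.
(* positivity of [A] at [x - A x / M] *)
have AM x : hnorm (A x) ^+ 2 <= M * rdot (A x) x.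
  have := rdot_positive_ge0 (x - (ofR M^-1 : F) *: A x) pA.
  rewrite opB// opZ// rdotBl !rdotBr !rdotZl !rdotZr rdot_sqr.
  rewrite (rdot_positiveC (A x))// rdot_sqr.
  have h : rdot (A (A x)) (A x) <= M * hnorm (A x) ^+ 2.
    apply: le_trans (rdot_le _ _) _.
    by rewrite expr2 mulrA ler_wpM2r ?hnorm_ge0.
  have k : M^-1 * rdot (A (A x)) (A x) <= hnorm (A x) ^+ 2 by rewrite ler_pdivrMl.
  have k' : M^-1 * (M^-1 * rdot (A (A x)) (A x)) <= M^-1 * hnorm (A x) ^+ 2.
    by rewrite ler_pM2l ?invr_gt0.
  by move=> h0; rewrite -ler_pdivrMl//; lra.
have nC x : hnorm (C x) <= hnorm x.
  rewrite -ler_sqr ?nnegrE ?hnorm_ge0// sqr_hnormB rdotZr hnormZr exprMn.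
  rewrite ger0_norm ?invr_ge0 ?(ltW M0)// rdotC.
  have h := rdot_positive_ge0 x pA.
  have h1 : M^-1 ^+ 2 * hnorm (A x) ^+ 2 <= M^-1 * rdot (A x) x.
    rewrite expr2 -mulrA ler_pM2l ?invr_gt0// mulrC ler_pdivrMr// mulrC.
    exact: AM.
  have h2 : 0 <= M^-1 * rdot (A x) x by rewrite mulr_ge0// invr_ge0 ltW.
  lra.
have [X [lX sX nX eX]] := contraction_iteration lC sC nC.
pose B x := (ofR (Num.sqrt M) : F) *: (x - X x).
have lB : linear B.
  move=> c x y; rewrite /B lX opprD addrACA -scalerBr.
  exact: scaler_linear.
exists B; split.
  apply: positive_operatorI.
  - split=> //; exists (Num.sqrt M * 2) => x; rewrite hnormZr ger0_norm ?sqrtr_ge0//.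
    rewrite -mulrA; apply: ler_wpM2l; first exact: sqrtr_ge0.
    apply: le_trans (hnormB _ _) _.
    by have := nX x; lra.
  - by move=> x y; rewrite rdotZl rdotZr rdotBl rdotBr sX.
  - move=> x; rewrite rdotZl; apply: mulr_ge0; rewrite ?sqrtr_ge0//.
    rewrite rdotBl rdot_sqr subr_ge0.
    apply: le_trans (rdot_le _ _) _.
    by rewrite expr2 ler_wpM2r ?hnorm_ge0.
apply/funext => x /=; rewrite /B (opZ lX) -scalerBr scalerA -rmorphM/=.
rewrite -expr2 sqr_sqrtr ?(ltW M0)// (opB lX) opprB addrA.
have -> : x - X x + X (X x) - X x = x - C x.
  have -> : C x = X x + X x - X (X x).
    by have := eX x; rewrite rmorph_nat scaler_nat mulr2n => ->; rewrite addrK.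
  by rewrite opprB opprD !addrA [x + _ - _]addrAC.
rewrite /C opprB addrC subrK scalerA -rmorphM/=.
by rewrite mulfV ?rmorph1 ?scale1r// gt_eqF.
Qed.

Lemma sqrt_operatorP A : positive_operator A ->
  positive_operator (sqrt_operator A) /\ sqrt_operator A \o sqrt_operator A = A.
Proof.
move=> pA; rewrite /sqrt_operator.
apply: (@xgetPex _ _ (fun B => positive_operator B /\ B \o B = A)).
exact: positive_sqrt_exists.
Qed.

Lemma sqr_hnorm_sqrt_operator A x : positive_operator A ->
  hnorm (sqrt_operator A x) ^+ 2 = rdot (A x) x.
Proof.
move=> /sqrt_operatorP[pB BB].
by rewrite -rdot_sqr -rdot_positiveC// -[in RHS]BB.
Qed.

End PositiveSquareRoot.

(** * Bessel fusion sequences and frame operators *)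

Section PartialSums.
Variables (R : realType) (I : choiceType).

Lemma partial_sumE (V : zmodType) (x : I -> V) (J : {fset I}) :
  partial_sum x J = \sum_(i <- J) x i.
Proof. by rewrite /partial_sum big_seq_fsetE. Qed.

Lemma partial_sum_ge0 (a : I -> R) J : (forall i, 0 <= a i) ->
  0 <= partial_sum a J.
Proof. by move=> a0; rewrite partial_sumE; exact: sumr_ge0. Qed.

Lemma partial_sumD (V : zmodType) (x : I -> V) (J1 J2 : {fset I}) :
  (J1 `<=` J2)%fset ->
  partial_sum x J2 = partial_sum x J1 + partial_sum x (J2 `\` J1)%fset.
Proof.
move=> J12; rewrite !partial_sumE (big_fsetID _ [pred i | i \in J1])/=.
congr (_ + _); apply: perm_big; apply: uniq_perm => // i.
  rewrite !inE/=; have := fsubsetP J12 i.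
  by case: (i \in J1) => [->//|_]; rewrite ?andbF.
by rewrite !inE/= andbC.
Qed.

Lemma esum_leP (a : I -> R) (c : R) :
  (\esum_(i in [set: I]) (a i)%:E <= c%:E)%E <->
  forall J, partial_sum a J <= c.
Proof.
split=> [h J|h].
  rewrite -lee_fin; apply: le_trans h; apply: esum_ge.
  exists [set` J]; first by split => //; exact: finite_fset.
  by rewrite -fsbig_seq ?fset_uniq// partial_sumE sumEFin.
apply: ge_ereal_sup => _ [A [finA _] <-].
rewrite -(fset_setK finA) -fsbig_seq ?fset_uniq// sumEFin lee_fin -partial_sumE.
exact: h.
Qed.

End PartialSums.

Section Fusion.
Variables (R : realType) (F : realOrComplexType R) (H : hilbertType F).
Variables (I : countType) (W : I -> set H) (w : I -> R).
Implicit Types (x y : H) (a : I -> H) (J : {fset I}).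

Lemma rdot_partial_sum a y J :
  rdot (partial_sum a J) y = partial_sum (fun i => rdot (a i) y) J.
Proof.
rewrite !partial_sumE; apply: (big_morph (fun x => rdot x y)).
  by move=> u v; rewrite rdotDl.
exact: rdot0l.
Qed.

Lemma ell2_norm_partial_sum a J : ell2_sum W a ->
  partial_sum (fun i => hnorm (a i) ^+ 2) J <= ell2_norm a ^+ 2.
Proof.
move=> [_ fin]; move: J; apply/esum_leP.
have e0 : (0 <= \esum_(i in [set: I]) (hnorm (a i) ^+ 2)%:E)%E.
  by apply: esum_ge0 => i _; rewrite lee_fin sqr_ge0.
by rewrite sqr_sqrtr ?fine_ge0// fineK// ge0_fin_numE.
Qed.

Lemma ell2_norm_le a (c : R) : (forall i, W i (a i)) -> 0 <= c ->
  (forall J, partial_sum (fun i => hnorm (a i) ^+ 2) J <= c ^+ 2) ->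
  ell2_sum W a /\ ell2_norm a <= c.
Proof.
move=> Wa c0 /esum_leP h.
have e0 : (0 <= \esum_(i in [set: I]) (hnorm (a i) ^+ 2)%:E)%E.
  by apply: esum_ge0 => i _; rewrite lee_fin sqr_ge0.
have fin : (\esum_(i in [set: I]) (hnorm (a i) ^+ 2)%:E < +oo)%E.
  exact: le_lt_trans h (ltry _).
split=> //; rewrite /ell2_norm -[leRHS](ger0_norm c0) -sqrtr_sqr ler_wsqrtr//.
by rewrite -lee_fin fineK// ge0_fin_numE.
Qed.

Hypothesis bW : bessel_fusion W w.

Let sW i : closed_subspace (W i). Proof. by case: bW. Qed.

Lemma bessel_bound : exists2 B : R, 0 <= B & forall x J,
  partial_sum (fun i => w i ^+ 2 * hnorm (proj (W i) x) ^+ 2) J <= B * hnorm x ^+ 2.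
Proof.
case: bW => _ _ [B hB]; exists `|B| => // x J.
apply: (@le_trans _ _ (B * hnorm x ^+ 2)).
  by move: J; apply/esum_leP.
by rewrite ler_wpM2r ?sqr_ge0// ler_norm.
Qed.

(** Cauchy-Schwarz between the coefficients [a] and the family
    [w i *: proj (W i) y]. *)
Lemma sqr_rdot_synthesis_le a y J : (forall i, W i (a i)) ->
  rdot (partial_sum (fun i => (ofR (w i) : F) *: a i) J) y ^+ 2 <=
  partial_sum (fun i => w i ^+ 2 * hnorm (proj (W i) y) ^+ 2) J *
  partial_sum (fun i => hnorm (a i) ^+ 2) J.
Proof.
(* the discriminant of the sum over [i] of
   [hnorm (a i + t * w i *: proj (W i) y) ^+ 2] *)
move=> Wa; apply: discriminant_le => [|t].
  by apply: partial_sum_ge0 => i; rewrite mulr_ge0 ?sqr_ge0.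
rewrite rdot_partial_sum !partial_sumE !mulr_sumr -!big_split/=.
apply: sumr_ge0 => i _.
have := sqr_ge0 (hnorm (a i + (ofR (t * w i) : F) *: proj (W i) y)).
rewrite sqr_hnormD rdotZr hnormZr exprMn real_normK ?num_real// rdot_proj//.
by rewrite rdotZl exprMn !mulrA.
Qed.

Let frame_term x i : H := (ofR (w i ^+ 2) : F) *: proj (W i) x.

(* the case [a i := w i *: proj (W i) x] of the synthesis bound, at
   [y := partial_sum (frame_term x) J] *)
Let sqr_hnorm_frame_term (B : R) : 0 <= B ->
  (forall x J, partial_sum (fun i => w i ^+ 2 * hnorm (proj (W i) x) ^+ 2) J <=
    B * hnorm x ^+ 2) ->
  forall x J, hnorm (partial_sum (frame_term x) J) ^+ 2 <=
    B * partial_sum (fun i => w i ^+ 2 * hnorm (proj (W i) x) ^+ 2) J.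
Proof.
move=> B0 hB x J; set y := partial_sum (frame_term x) J; set b := partial_sum _ J.
have aW i : W i ((ofR (w i) : F) *: proj (W i) x).
  by apply: closed_subspaceZ => //; exact: proj_in.
have := sqr_rdot_synthesis_le y J aW.
have -> : partial_sum
    (fun i => (ofR (w i) : F) *: ((ofR (w i) : F) *: proj (W i) x)) J = y.
  rewrite /y; congr (partial_sum _ _); apply/funext => i.
  by rewrite scalerA -rmorphM.
have -> : partial_sum (fun i => hnorm ((ofR (w i) : F) *: proj (W i) x) ^+ 2) J = b.
  congr (partial_sum _ _); apply/funext => i.
  by rewrite hnormZr exprMn real_normK ?num_real.
rewrite rdot_sqr => h.
have b0 : 0 <= b by apply: partial_sum_ge0 => i; rewrite mulr_ge0 ?sqr_ge0.
have {h} := le_trans h (ler_wpM2r b0 (hB y J)).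
have [->|n0] := eqVneq (hnorm y) 0; first by rewrite expr0n mulr_ge0.
have n1 : 0 < hnorm y by rewrite lt_neqAle eq_sym n0 hnorm_ge0.
by rewrite mulrAC [leLHS]expr2 ler_pM2r ?exprn_gt0.
Qed.

Lemma frame_operator_cvg x :
  partial_sum (frame_term x) @ totally --> frame_operator W w x.
Proof.
suff [z hz] : exists z : H, partial_sum (frame_term x) @ totally --> z.
  by rewrite /frame_operator /sum; apply/cvg_ex; exists z.
apply: hcauchy => e e0.
have [B B0 hB] := bessel_bound.
pose b i := w i ^+ 2 * hnorm (proj (W i) x) ^+ 2.
pose S := range (partial_sum b).
have supS : has_sup S.
  split; first by exists (partial_sum b fset0), fset0.
  by exists (B * hnorm x ^+ 2) => _ [J _ <-]; exact: hB.
have d0 : 0 < (e / 2) ^+ 2 / (B + 1) by rewrite divr_gt0 ?exprn_gt0 ?divr_gt0// ltr_wpDl.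
(* beyond [A], the partial sums of [b] vary by less than
   [(e / 2) ^+ 2 / (B + 1)] *)
have [_ [A _ <-] hA] := sup_adherent d0 supS.
have near_A J : (A `<=` J)%fset ->
    hnorm (partial_sum (frame_term x) J - partial_sum (frame_term x) A) < e / 2.
  move=> AJ; rewrite (partial_sumD _ AJ) addrAC subrr add0r.
  set J' := (J `\` A)%fset.
  set y := partial_sum _ _.
  have bJ' : partial_sum b J' < (e / 2) ^+ 2 / (B + 1).
    have : partial_sum b J <= sup S by apply: ub_le_sup; [exact: supS.2|exists J].
    by move: hA; rewrite (partial_sumD b AJ) -/J'; lra.
  have h := sqr_hnorm_frame_term B0 hB x J'.
  have b0 : 0 <= partial_sum b J'.
    by apply: partial_sum_ge0 => i; rewrite mulr_ge0 ?sqr_ge0.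
  rewrite -ltr_sqr ?nnegrE ?hnorm_ge0 ?divr_ge0 ?(ltW e0)//.
  apply: le_lt_trans h _; move: bJ'; rewrite ltr_pdivlMr ?ltr_wpDl//.
  by nra.
exists [set J | (A `<=` J)%fset]; first by exists A.
move=> s t /near_A hs /near_A ht.
apply: le_lt_trans (hnorm_dist _ (partial_sum (frame_term x) A) _) _.
by rewrite [X in _ + X]hnormB_sym; lra.
Qed.

Let term_symmetric J x y :
  rdot (partial_sum (frame_term x) J) y = rdot x (partial_sum (frame_term y) J).
Proof.
rewrite [RHS]rdotC !rdot_partial_sum; congr (partial_sum _ _); apply/funext => i.
by rewrite !rdotZl rdot_projC// [in RHS]rdotC.
Qed.

Let term_sqr J x : rdot (partial_sum (frame_term x) J) x =
  partial_sum (fun i => w i ^+ 2 * hnorm (proj (W i) x) ^+ 2) J.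
Proof.
rewrite rdot_partial_sum; congr (partial_sum _ _); apply/funext => i.
by rewrite rdotZl sqr_hnorm_proj// rdotC.
Qed.

(** The partial sums of [w i ^+ 2 * hnorm (proj (W i) x) ^+ 2] increase to
    [rdot (frame_operator W w x) x]. *)
Lemma partial_sum_le_frame_operator x J :
  partial_sum (fun i => w i ^+ 2 * hnorm (proj (W i) x) ^+ 2) J <=
  rdot (frame_operator W w x) x.
Proof.
have cv : rdot (partial_sum (frame_term x) J') x @[J' --> totally] -->
    rdot (frame_operator W w x) x.
  by apply: rdot_cvg; exact: frame_operator_cvg.
apply: (cvgr_to_ge cv); exists J => // J' /= JJ'.
rewrite term_sqr (partial_sumD _ JJ') lerDl.
by apply: partial_sum_ge0 => i; rewrite mulr_ge0 ?sqr_ge0.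
Qed.

Lemma frame_operator_positive : positive_operator (frame_operator W w).
Proof.
have symS x y : rdot (frame_operator W w x) y = rdot x (frame_operator W w y).
  by apply: (@symmetric_limit _ _ H _ totally _ _ _ (term_symmetric) frame_operator_cvg).
apply: positive_operatorI => //; last first.
  move=> x; apply: le_trans (partial_sum_le_frame_operator x fset0).
  by rewrite partial_sumE big_seq_fset0.
split.
  apply: (@linear_limit _ _ H _ totally
    (fun J x => partial_sum (frame_term x) J) _ _ _ frame_operator_cvg).
  move=> J c x y; rewrite !partial_sumE scaler_sumr -big_split/=.
  apply: eq_bigr => i _; rewrite /frame_term (proj_linear (sW i)).
  exact: scaler_linear.
have [B B0 hB] := bessel_bound; exists B => x.
apply: (hnorm_limit_le _ _ (@frame_operator_cvg x)) => J.
rewrite -ler_sqr ?nnegrE ?mulr_ge0 ?hnorm_ge0// exprMn.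
apply: le_trans (sqr_hnorm_frame_term B0 hB x J) _.
by rewrite (expr2 B) -mulrA ler_wpM2l.
Qed.

End Fusion.

(** * Atomic systems *)

Section AtomicSystems.
Variables (R : realType) (F : realOrComplexType R) (H : hilbertType F).
Variables (I : countType) (W : I -> set H) (w : I -> R).
Implicit Types (K T P : H -> H) (x y : H) (a : I -> H) (J : {fset I}).

Lemma bounded_quotientI (U V : H -> H) :
  (exists M : R, forall x, hnorm (U x) <= M * hnorm (V x)) -> bounded_quotient U V.
Proof.
move=> [M hM]; split=> [x /= Vx|].
  apply: hnorm_eq0; apply/eqP; rewrite eq_le hnorm_ge0 andbT.
  by apply: le_trans (hM x) _; rewrite Vx hnorm0 mulr0.
exists M => y [x _ Vxy]; rewrite /quotient_operator; set z := xget _ _.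
have Vz : V z = y by apply: (@xgetPex _ 0 [set z | V z = y]); exists x.
by rewrite -[in leRHS]Vz.
Qed.

(** The lower frame inequality of an atomic system for [K], obtained by pairing
    the atomic decomposition of [K x] with [y] at [x := adjoint K y]. *)
Lemma atomic_system_lower_bound K : bounded_operator K -> atomic_system W w K ->
  exists2 C : R, 0 <= C & forall y,
    hnorm (adjoint K y) ^+ 2 <= C ^+ 2 * rdot (frame_operator W w y) y.
Proof.
move=> bK [bW [C [C0 hC]]]; exists C => [|y]; first exact: ltW.
have S0 : 0 <= rdot (frame_operator W w y) y.
  exact: rdot_positive_ge0 (frame_operator_positive bW).
set x := adjoint K y; have [a [la na cva]] := hC x.
pose D := rdot (frame_operator W w y) y * (C * hnorm x) ^+ 2.
have le_D J : rdot (partial_sum (fun i => (ofR (w i) : F) *: a i) J) y <= Num.sqrt D.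
  apply: le_trans (ler_norm _) _; rewrite -sqrtr_sqr ler_wsqrtr//.
  apply: le_trans (sqr_rdot_synthesis_le bW y J la.1) _; apply: ler_pM.
  - by apply: partial_sum_ge0 => i; rewrite mulr_ge0 ?sqr_ge0.
  - by apply: partial_sum_ge0 => i; rewrite sqr_ge0.
  - exact: partial_sum_le_frame_operator.
  apply: le_trans (ell2_norm_partial_sum J la) _.
  by rewrite ler_sqr ?nnegrE ?sqrtr_ge0// mulr_ge0 ?hnorm_ge0// ltW.
have cv : rdot (partial_sum (fun i => (ofR (w i) : F) *: a i) J) y @[J --> totally]
    --> rdot (K x) y by exact: rdot_cvg.
have : rdot (K x) y <= Num.sqrt D.
  by apply: (cvgr_to_le cv); apply: nearW => J; exact: le_D.
rewrite rdot_adjoint// -/x rdot_sqr => h.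
have D0 : 0 <= D by rewrite mulr_ge0 ?sqr_ge0.
have {h} h : hnorm x ^+ 2 * hnorm x ^+ 2 <= D.
  by rewrite -expr2 -(sqr_sqrtr D0) ler_sqr ?nnegrE ?sqr_ge0 ?sqrtr_ge0.
have [->|n0] := eqVneq (hnorm x) 0.
  by rewrite expr0n mulr_ge0 ?sqr_ge0.
have n1 : 0 < hnorm x by rewrite lt_neqAle eq_sym n0 hnorm_ge0.
move: h; rewrite /D exprMn [leRHS]mulrA ler_pM2r ?exprn_gt0//.
by rewrite mulrC.
Qed.

(** The image of an atomic system under [T], when [T] has a bounded right
    inverse [P] on its closed range such that [P \o T] preserves each [W i]. *)
Section Image.
Variables (T P : H -> H).
Hypotheses (bT : bounded_operator T) (bP : bounded_operator P).
Hypothesis clT : closed (range T).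
Hypothesis TPK : forall y, range T y -> T (P y) = y.
Hypothesis PTW : forall i, (P \o T) @` W i `<=` W i.
Hypothesis bW : bessel_fusion W w.

Let sW i : closed_subspace (W i). Proof. by case: bW. Qed.

Lemma image_closed_subspace i : closed_subspace (T @` W i).
Proof.
have [cW W0 W_lin] := sW i; split.
- have -> : T @` W i = range T `&` P @^-1` W i.
    apply/seteqP; split=> [_ [x Wx <-]|y [Ry WPy]].
      by split; [exists x|apply: PTW; exists x].
    by exists (P y) => //; exact: TPK.
  apply: closedI => //; apply: closed_comp cW => x _.
  by apply: bounded_cvg => //; exact: cvg_id.
- by exists 0 => //; exact: op0 bT.1.
- move=> c _ _ [x Wx <-] [y Wy <-]; exists (c *: x + y); first exact: W_lin.
  by rewrite bT.1.
Qed.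

Lemma image_bessel_fusion : bessel_fusion (fun i => T @` W i) w.
Proof.
split; [exact: image_closed_subspace|by case: bW|].
have [B B0 hB] := bessel_bound bW.
have [M M0 hM] := bounded_operatorP bP.
have [N N0 hN] := bounded_operatorP (adjoint_bounded bT).
exists (M ^+ 2 * (B * N ^+ 2)) => x; apply/esum_leP => J.
have le_proj i : hnorm (proj (T @` W i) x) <= M * hnorm (proj (W i) (adjoint T x)).
  have sTW := image_closed_subspace i.
  set p := proj (T @` W i) x; have [u Wu Tu] := proj_in sTW x.
  have [->|n0] := eqVneq (hnorm p) 0.
    by rewrite mulr_ge0 ?hnorm_ge0// ltW.
  have n1 : 0 < hnorm p by rewrite lt_neqAle eq_sym n0 hnorm_ge0.
  have WPp : W i (P p) by apply: PTW; exists u => //=; rewrite Tu.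
  have TPp : T (P p) = p by apply: TPK; exists u.
  rewrite -(ler_pM2r n1) -expr2 sqr_hnorm_proj// -/p rdotC -{1}TPp.
  rewrite rdot_adjoint// -(rdot_proj (sW i))//.
  apply: le_trans (rdot_le _ _) _; rewrite mulrAC ler_wpM2r ?hnorm_ge0//.
pose b i := w i ^+ 2 * hnorm (proj (W i) (adjoint T x)) ^+ 2.
apply: (@le_trans _ _ (M ^+ 2 * partial_sum b J)).
  rewrite !partial_sumE mulr_sumr; apply: ler_sum => i _.
  rewrite [leRHS]mulrCA ler_wpM2l ?sqr_ge0// -exprMn.
  by rewrite ler_sqr ?nnegrE ?mulr_ge0 ?hnorm_ge0// ltW.
rewrite -[leRHS]mulrA; apply: ler_wpM2l; first exact: sqr_ge0.
apply: le_trans (hB _ _) _; rewrite -[leRHS]mulrA.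
rewrite ler_wpM2l// -exprMn.
by rewrite ler_sqr ?nnegrE ?mulr_ge0 ?hnorm_ge0// ltW.
Qed.

Lemma image_atomic_system K : atomic_system W w K ->
  atomic_system (fun i => T @` W i) w (T \o K).
Proof.
move=> [_ [C [C0 hC]]]; split; first exact: image_bessel_fusion.
have [N N0 hN] := bounded_operatorP bT.
exists (N * C); split; first exact: mulr_gt0.
move=> x; have [a [la na cva]] := hC x; exists (T \o a).
have [|||lTa nTa] := @ell2_norm_le _ _ H I (fun i => T @` W i) (T \o a) (N * C * hnorm x).
- by move=> i; exists (a i) => //; exact: la.1.
- by rewrite mulr_ge0 ?hnorm_ge0// ltW// mulr_gt0.
- move=> J; apply: (@le_trans _ _ (N ^+ 2 * partial_sum (fun i => hnorm (a i) ^+ 2) J)).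
    rewrite !partial_sumE mulr_sumr; apply: ler_sum => i _ /=; rewrite -exprMn.
    by rewrite ler_sqr ?nnegrE ?mulr_ge0 ?hnorm_ge0// ltW.
  rewrite -mulrA exprMn ler_wpM2l ?sqr_ge0//.
  apply: le_trans (ell2_norm_partial_sum J la) _.
  by rewrite ler_sqr ?nnegrE ?sqrtr_ge0// mulr_ge0 ?hnorm_ge0// ltW.
split=> //.
have : T \o partial_sum (fun i => (ofR (w i) : F) *: a i) @ totally --> T (K x).
  exact: bounded_cvg.
rewrite (_ : T \o _ = partial_sum (fun i => (ofR (w i) : F) *: (T \o a) i))//.
apply/funext => J /=; rewrite !partial_sumE op_sum; last exact: bT.1.
by apply: eq_bigr => i _; rewrite opZ//; exact: bT.1.
Qed.

End Image.
End AtomicSystems.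

Theorem theorem15 (R : realType) (F : realOrComplexType R) (H : hilbertType F)
    (I : countType) (K T : H -> H) (W : I -> set H) (w : I -> R) :
  separable_space H ->
  bounded_operator K ->
  atomic_system W w K ->
  bounded_operator T ->
  closed (range T) ->
  (forall i, (pseudo_inverse T \o T) @` W i `<=` W i) ->
  [<-> atomic_system (fun i => T @` W i) w (T \o K);
       bounded_quotient (adjoint (T \o K))
         (sqrt_operator (frame_operator W w) \o adjoint T);
       bounded_quotient (adjoint (T \o K))
         (sqrt_operator (T \o frame_operator W w \o adjoint T))].
Proof.
move=> _ bK aW bT clT PTW.
have bW := aW.1.
have [bP _ _ TPK] := pseudo_inverseP bT clT.
have pS := frame_operator_positive bW.
have bT' := adjoint_bounded bT.
have pTST : positive_operator (T \o frame_operator W w \o adjoint T).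
  apply: positive_operatorI.
  - by apply: bounded_comp => //; apply: bounded_comp => //; case: pS.
  - move=> x y /=; rewrite rdot_adjoint// rdot_positiveC//.
    by rewrite rdotC [RHS]rdotC [RHS]rdot_adjoint.
  - by move=> x /=; rewrite rdot_adjoint//; exact: rdot_positive_ge0.
have [C C0 hC] := atomic_system_lower_bound bK aW.
have bound x : hnorm (adjoint (T \o K) x) ^+ 2 <=
    C ^+ 2 * rdot (frame_operator W w (adjoint T x)) (adjoint T x).
  by rewrite adjoint_comp; [exact: hC|exact: bT|exact: bK].
tfae=> _.
- apply: bounded_quotientI; exists C => x.
  rewrite -ler_sqr ?nnegrE ?mulr_ge0 ?hnorm_ge0// exprMn.
  by rewrite sqr_hnorm_sqrt_operator.
- apply: bounded_quotientI; exists C => x.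
  rewrite -ler_sqr ?nnegrE ?mulr_ge0 ?hnorm_ge0// exprMn.
  by rewrite sqr_hnorm_sqrt_operator//= rdot_adjoint.
- exact: image_atomic_system bT bP clT TPK PTW bW _ aW.
Qed.
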